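(* Let $a,b\in I$ with $a<s_0<b$. Let $f:[a,b]\to\mathbb{R}$ be an absolutely $\beta$-integrable function on $[a,b]$, and suppose that there exist real numbers $m$ and $M$ such that $m\le f(x)\le M$ for all $x\in[a,b]_\beta$. If $u:[a,b]\to\mathbb{R}$ is such that $D_\beta u$ is bounded on $[a,b]_\beta$ and $\lim_{n\to\infty}u(\beta^n(x))$ exists for $x=a$ and for $x=b$, then $$\left|\int_a^b f(x)\,d_\beta u(x)-\frac{u(b)-u(a)-\left(u(s_0^+)-u(s_0^-)\right)}{b-a}\int_a^b f(t)\,d_\beta t\right|\le\frac12\|D_\beta u\|_\infty(M-m)(b-a),$$ where $\|D_\beta u\|_\infty:=\sup_{t\in[a,b]_\beta}|(D_\beta u)(t)|$. The constant $\frac12$ is the best possible: there is no constant $c<\frac12$ such that the inequality with $\frac12$ replaced by $c$ holds for all admissible data $(I,\beta,a,b,f,u,m,M)$.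
   Context: Setting: $I\subseteq\mathbb{R}$ is an interval and $\beta:I\to I$ is a strictly increasing continuous function with exactly one fixed point $s_0\in I$, satisfying $(t-s_0)(\beta(t)-t)\le 0$ for all $t\in I$, with equality only if $t=s_0$. Write $\beta^0(t)=t$ and $\beta^k$ for the $k$-fold composition of $\beta$ with itself. For $a,b\in I$, $[a,b]_\beta:=\{\beta^k(a):k\ge 0\}\cup\{\beta^k(b):k\ge 0\}\cup\{s_0\}$. The $\beta$-integral is $\int_a^b h\,d_\beta:=\int_{s_0}^b h\,d_\beta-\int_{s_0}^a h\,d_\beta$, where $\int_{s_0}^x h\,d_\beta:=\sum_{k=0}^{\infty}\big(\beta^k(x)-\beta^{k+1}(x)\big)h\big(\beta^k(x)\big)$; also written $\int_a^b h(x)\,d_\beta x$. The function $h$ is $\beta$-integrable on $[a,b]$ if these series converge for $x=a$ and $x=b$, and absolutely $\beta$-integrable on $[a,b]$ if $|h|$ is $\beta$-integrable on $[a,b]$. The $\beta$-derivative is $(D_\beta u)(t):=\frac{u(\beta(t))-u(t)}{\beta(t)-t}$ for $t\ne s_0$, and $(D_\beta u)(s_0):=u'(s_0)$ if this derivative exists. Here $u$ need not be differentiable, or even continuous, at $s_0$: boundedness of $D_\beta u$ on $[a,b]_\beta$ and the supremum $\|D_\beta u\|_\infty$ refer to the points $t\in[a,b]_\beta$ with $t\neq s_0$ (when $u'(s_0)$ exists, including $t=s_0$ does not change the supremum). Riemann–Stieltjes $\beta$-integral: for a real function $u$ of bounded variation on $[a,b]_\beta$ (automatic when $D_\beta u$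 is bounded), $$\int_a^b f(x)\,d_\beta u(x):=\sum_{k=0}^\infty f(\beta^k(b))\big(u(\beta^k(b))-u(\beta^{k+1}(b))\big)-\sum_{k=0}^\infty f(\beta^k(a))\big(u(\beta^k(a))-u(\beta^{k+1}(a))\big).$$ Notation: $u(s_0^+):=\lim_{n\to\infty}u(\beta^n(b))$ and $u(s_0^-):=\lim_{n\to\infty}u(\beta^n(a))$. *)

(* Defs.v *)
From HB Require Import structures.
From mathcomp Require Import all_boot all_order all_algebra.
From mathcomp Require Import all_classical all_reals all_analysis.
Import Order.TTheory GRing.Theory Num.Theory numFieldNormedType.Exports.

Set Implicit Arguments.
Unset Strict Implicit.
Unset Printing Implicit Defensive.

Local Open Scope classical_set_scope.
Local Open Scope ring_scope.

(* Functions given on I or on [a, b] are represented by total functions on R;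
   every notion below only evaluates them at points of their domain (for the
   derivative at s0, at points near s0). *)
Record quantum_map (R : realType) (I : set R) (beta : R -> R) (s0 : R) : Prop :=
  QuantumMap {
    qm_interval : is_interval I;
    qm_maps : forall t, I t -> I (beta t);
    qm_increasing : forall s t, I s -> I t -> s < t -> beta s < beta t;
    qm_continuous : {within I, continuous beta};
    qm_fixed_mem : I s0;
    qm_fixed : beta s0 = s0;
    qm_fixed_unique : forall t, I t -> beta t = t -> t = s0;
    qm_contract : forall t, I t -> (t - s0) * (beta t - t) <= 0;
    qm_contract_eq : forall t, I t -> (t - s0) * (beta t - t) = 0 -> t = s0
  }.

Definition beta_interval (R : realType) (beta : R -> R) (s0 a b : R) : set R :=
  [set iter k beta a | k in [set: nat]] `|`
  [set iter k beta b | k in [set: nat]] `|` [set s0].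

Definition beta_term (R : realType) (beta h : R -> R) (x : R) : R^nat :=
  fun k => (iter k beta x - iter k.+1 beta x) * h (iter k beta x).

Definition beta_integral0 (R : realType) (beta h : R -> R) (x : R) : R :=
  limn (series (beta_term beta h x)).

Definition beta_integral (R : realType) (beta : R -> R) (a b : R)
    (h : R -> R) : R :=
  beta_integral0 beta h b - beta_integral0 beta h a.

Definition beta_integrable (R : realType) (beta : R -> R) (a b : R)
    (h : R -> R) : Prop :=
  cvgn (series (beta_term beta h a)) /\ cvgn (series (beta_term beta h b)).

Definition abs_beta_integrable (R : realType) (beta : R -> R) (a b : R)
    (h : R -> R) : Prop :=
  beta_integrable beta a b (fun x => `|h x|).

Definition beta_derive (R : realType) (beta : R -> R) (s0 : R) (u : R -> R)
    (t : R) : R :=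
  if t == s0 then derive1 u s0 else (u (beta t) - u t) / (beta t - t).

(* u need not be differentiable at s0, so boundedness and the supremum range
   over the points of [a, b]_beta other than s0. *)
Definition beta_derive_bounded (R : realType) (beta : R -> R) (s0 a b : R)
    (u : R -> R) : Prop :=
  [bounded beta_derive beta s0 u t | t in beta_interval beta s0 a b `\ s0].

Definition beta_derive_norm (R : realType) (beta : R -> R) (s0 a b : R)
    (u : R -> R) : R :=
  sup [set `|beta_derive beta s0 u t| |
       t in beta_interval beta s0 a b `\ s0].

Definition stieltjes_term (R : realType) (beta f u : R -> R) (x : R) : R^nat :=
  fun k => f (iter k beta x) * (u (iter k beta x) - u (iter k.+1 beta x)).

Definition stieltjes_integrable (R : realType) (beta : R -> R) (a b : R)
    (f u : R -> R) : Prop :=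
  cvgn (series (stieltjes_term beta f u a)) /\
  cvgn (series (stieltjes_term beta f u b)).

Definition stieltjes_integral (R : realType) (beta : R -> R) (a b : R)
    (f u : R -> R) : R :=
  limn (series (stieltjes_term beta f u b)) -
  limn (series (stieltjes_term beta f u a)).

(* With x = b this is u(s0^+), and with x = a it is u(s0^-). *)
Definition orbit_lim (R : realType) (beta u : R -> R) (x : R) : R :=
  limn (fun n => u (iter n beta x)).

Record admissible (R : realType) (I : set R) (beta : R -> R) (s0 a b : R)
    (f u : R -> R) (m M : R) : Prop :=
  Admissible {
    adm_map : quantum_map I beta s0;
    adm_a : I a;
    adm_b : I b;
    adm_lt_a : a < s0;
    adm_lt_b : s0 < b;
    adm_integrable : abs_beta_integrable beta a b f;
    adm_range : forall x, beta_interval beta s0 a b x -> m <= f x <= M;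
    adm_derive : beta_derive_bounded beta s0 a b u;
    adm_lim_a : cvgn (fun n => u (iter n beta a));
    adm_lim_b : cvgn (fun n => u (iter n beta b))
  }.

Definition gruss_estimate (R : realType) (c : R) (beta : R -> R) (s0 a b : R)
    (f u : R -> R) (m M : R) : Prop :=
  `| stieltjes_integral beta a b f u
     - (u b - u a - (orbit_lim beta u b - orbit_lim beta u a)) / (b - a)
       * beta_integral beta a b f |
  <= c * beta_derive_norm beta s0 a b u * (M - m) * (b - a).

(* Main.v *)
Require Import Defs.
From mathcomp Require Import all_boot all_order all_algebra.
From mathcomp Require Import all_classical all_reals all_analysis.
From mathcomp Require Import ring lra.
Import Order.TTheory GRing.Theory Num.Theory numFieldNormedType.Exports.
Local Open Scope classical_set_scope.
Local Open Scope ring_scope.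

(** Since [u x - u (beta x) = (x - beta x) * D_beta u x] along the orbits of [a]
    and [b], the estimate is a Gruss inequality for [f] and [d = D_beta u] with
    weights the gaps between consecutive orbit points, of total mass [b - a].
    With [mu] the weighted mean of [d] and [h = (m + M) / 2], the left side is
    the sum of [w (f - h) (d - mu)], at most [(M - m) / 2] times the sum of
    [w |d - mu|], and the latter is at most [L] times the total mass because
    the variance of [d] is at most [L ^ 2]. This is done on finite pieces of
    the orbits before passing to the limit. Equality holds for [beta t = t / 2],
    [f = sgn] and [u = |.|] on [[-1, 1]]. *)

(** * Weighted Gruss inequality for finite sums *)

Lemma weighted_mean_deviation (R : realFieldType) (T : finType)
    (w d : T -> R) (L : R) :
  0 <= L -> (forall i, 0 <= w i) -> (forall i, `|d i| <= L) ->
  0 < \sum_i w i ->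
  \sum_i w i * `|d i - (\sum_j w j * d j) / \sum_j w j|
    <= L * \sum_i w i.
Proof.
move=> Lge0 w0 dL W0; set W := \sum_i w i; set mu := _ / _.
have muW : \sum_i w i * d i = mu * W by rewrite /mu divfK ?gt_eqF.
(* The main argument multiplies the goal by [L], so [L = 0] is separate; there [d] vanishes. *)
have [L0|L0] := leP L 0.
  have d0 i : d i = 0.
    by apply/eqP; rewrite -normr_le0 (le_trans (dL i)).
  have mu0 : mu = 0 by rewrite /mu big1 ?mul0r// => i _; rewrite d0 mulr0.
  rewrite big1 ?mulr_ge0 ?(ltW W0)// => i _.
  by rewrite d0 mu0 subrr normr0 mulr0.
rewrite -(ler_pM2l L0) -(ler_pM2l (ltr0Sn R 1)).
(* AM-GM: [2 L |d - mu| <= L ^ 2 + (d - mu) ^ 2] avoids square roots. *)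
have amgm i : 2 * (L * (w i * `|d i - mu|)) <=
    w i * (2 * L ^+ 2 + mu ^+ 2) - 2 * mu * (w i * d i).
  have -> : w i * (2 * L ^+ 2 + mu ^+ 2) - 2 * mu * (w i * d i) =
     w i * (L ^+ 2 + (L ^+ 2 - d i ^+ 2) + (d i - mu) ^+ 2) by ring.
  have -> : 2 * (L * (w i * `|d i - mu|)) = w i * (2 * L * `|d i - mu|) by ring.
  apply: ler_wpM2l => //.
  have dL2 : d i ^+ 2 <= L ^+ 2.
    by rewrite -[d i ^+ 2]real_normK ?num_real// lerXn2r ?nnegrE ?(ltW L0).
  rewrite -[(d i - mu) ^+ 2]real_normK ?num_real//.
  have := sqr_ge0 (L - `|d i - mu|); nra.
have : \sum_i 2 * (L * (w i * `|d i - mu|)) <=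
    \sum_i (w i * (2 * L ^+ 2 + mu ^+ 2) - 2 * mu * (w i * d i)).
  by apply: ler_sum.
(* By the choice of [mu] the summed bound equals [W * (2 * L ^+ 2 - mu ^+ 2)]. *)
rewrite sumrB -mulr_suml -!mulr_sumr muW -/W => /le_trans; apply.
have := mulr_ge0 (sqr_ge0 mu) (ltW W0); rewrite -/W; lra.
Qed.

Lemma gruss_finite (R : realFieldType) (T : finType) (w f d : T -> R)
    (L m M : R) :
  (forall i, 0 <= w i) -> (forall i, `|d i| <= L) ->
  (forall i, m <= f i <= M) -> 0 < \sum_i w i ->
  `|\sum_i w i * (f i * d i)
    - (\sum_i w i * d i) / (\sum_i w i) * \sum_i w i * f i|
  <= 1 / 2 * L * (M - m) * \sum_i w i.
Proof.
move=> w0 dL fmM W0.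
(* An index yields [m <= M] and [0 <= L]; without one the total mass would be zero. *)
have [i0|] := pickP (fun _ : T => true); last first.
  by move=> h; move: W0; rewrite big1 ?ltxx// => i _; have := h i.
move=> _; have mM : m <= M by case/andP: (fmM i0) => /le_trans h /h.
have L0 : 0 <= L by rewrite (le_trans _ (dL i0)).
have := weighted_mean_deviation R T w d L L0 w0 dL W0.
set W := \sum_i w i; set mu := (\sum_i w i * d i) / W => dev.
have muW : \sum_i w i * d i = mu * W by rewrite /mu divfK ?gt_eqF.
(* Subtracting the midrange of [f] is free, because [d - mu] has mean zero. *)
have -> : \sum_i w i * (f i * d i) - mu * \sum_i w i * f i =
    \sum_i (f i - (m + M) / 2) * (w i * (d i - mu)).
  have -> : \sum_i (f i - (m + M) / 2) * (w i * (d i - mu)) =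
      \sum_i (w i * (f i * d i) - mu * (w i * f i)
        - (m + M) / 2 * (w i * d i) + (m + M) / 2 * mu * w i).
    by apply: eq_bigr => i _; ring.
  rewrite big_split/= sumrB sumrB -!mulr_sumr muW -/W; ring.
have -> : 1 / 2 * L * (M - m) * W = (M - m) / 2 * (L * W) by ring.
apply: le_trans (ler_norm_sum _ _ _) _.
apply: le_trans (_ : \sum_i (M - m) / 2 * (w i * `|d i - mu|) <= _); last first.
  by rewrite -mulr_sumr ler_wpM2l// divr_ge0// subr_ge0.
apply: ler_sum => i _; rewrite !normrM (ger0_norm (w0 i)).
apply: ler_wpM2r; first by rewrite mulr_ge0.
by rewrite ler_norml; have := fmM i; lra.
Qed.

(** * Series tools *)

Lemma series_telescope (R : realType) (v : R^nat) (n : nat) :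
  series (fun k => v k - v k.+1) n = v 0%N - v n.
Proof.
rewrite seriesEnat/= -[RHS]opprB -(telescope_sumr v (leq0n n)) -sumrN.
by apply: eq_bigr => k _; rewrite opprB.
Qed.

(** Comparison test in which [c] may be negative: along the orbit of [a] the gaps, hence the terms
    of [w], are nonpositive. *)
Lemma is_cvg_series_dominated (R : realType) (c : R) (v w : R^nat) :
  (forall k, `|v k| <= c * w k) -> cvgn (series w) -> cvgn (series v).
Proof.
move=> vw cw; apply: normed_cvg.
have w0 k : 0 <= c * w k by exact: le_trans (vw k).
apply: (series_le_cvg (fun k => normr_ge0 (v k)) w0 vw).
exact: is_cvg_seriesZ cw.
Qed.

(** * Orbits and their convergence to the fixed point *)

Section orbits.
Context {R : realType} {I : set R} {beta : R -> R} {s0 : R}.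
Hypothesis qm : quantum_map I beta s0.

Lemma quantum_map_neq t : I t -> t != s0 -> beta t != t.
Proof.
move=> It; apply: contra => /eqP e.
by apply/eqP; apply: (qm_fixed_unique qm).
Qed.

Lemma quantum_map_lt t : I t -> s0 < t -> beta t < t.
Proof.
move=> It st; rewrite lt_neqAle quantum_map_neq ?gt_eqF//=.
by have := qm_contract qm It; rewrite pmulr_rle0 ?subr_gt0// subr_le0.
Qed.

Lemma quantum_map_gt t : I t -> t < s0 -> t < beta t.
Proof.
move=> It st; rewrite lt_neqAle eq_sym quantum_map_neq ?lt_eqF//=.
by have := qm_contract qm It; rewrite nmulr_rle0 ?subr_lt0// subr_ge0.
Qed.

Lemma orbit_mem x k : I x -> I (iter k beta x).
Proof. by move=> Ix; elim: k => //= k; apply: (qm_maps qm). Qed.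

Lemma orbit_gt x k : I x -> s0 < x -> s0 < iter k beta x.
Proof.
move=> Ix sx; elim: k => //= k h; rewrite -[ltLHS](qm_fixed qm).
by apply: (qm_increasing qm) => //; [exact: (qm_fixed_mem qm)|exact: orbit_mem].
Qed.

Lemma orbit_lt x k : I x -> x < s0 -> iter k beta x < s0.
Proof.
move=> Ix sx; elim: k => //= k h; rewrite -[ltRHS](qm_fixed qm).
by apply: (qm_increasing qm) => //; [exact: orbit_mem|exact: (qm_fixed_mem qm)].
Qed.

(** Continuity turns a limit inside [I] into a fixed point, and [s0] is the only one. The interval
    may fail to be closed, so the limit has to be placed in [I] beforehand. *)
Lemma orbit_cvg_fixed x : I x -> cvgn (fun n => iter n beta x) ->
  I (limn (fun n => iter n beta x)) -> iter n beta x @[n --> \oo] --> s0.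
Proof.
move=> Ix cx; set l := limn _ => Il.
have xl : iter n beta x @[n --> \oo] --> l by exact: cx.
suff <- : l = s0 by [].
apply: (qm_fixed_unique qm) => //.
have /subspace_continuousP/(_ l Il) bl := qm_continuous qm.
(* Continuity of [beta] is relative to [I], so the orbit must converge within [I]. *)
have xlI : iter n beta x @[n --> \oo] --> within I (nbhs l).
  move=> A /xl; rewrite /nbhs/= => -[N _ NA]; exists N => // n /NA; apply.
  exact: orbit_mem.
have h1 : iter n.+1 beta x @[n --> \oo] --> beta l := cvg_comp _ _ xlI bl.
have h2 : iter n.+1 beta x @[n --> \oo] --> l.
  by rewrite (cvg_shiftS (fun n => iter n beta x)).
exact: (cvg_unique _ h1 h2).
Qed.

(** The orbit decreases and stays above [s0], so its limit lies between [s0] and [x], hence in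
    [I]. *)
Lemma orbit_cvg_gt x : I x -> s0 < x -> iter n beta x @[n --> \oo] --> s0.
Proof.
move=> Ix sx.
have dec : {homo (fun n => iter n beta x) : n m / (n <= m)%N >-> m <= n}.
  apply/nonincreasing_seqP => n /=; apply/ltW/quantum_map_lt.
    exact: orbit_mem.
  exact: orbit_gt.
have cx : cvgn (fun n => iter n beta x).
  apply: nonincreasing_is_cvgn => //; exists s0 => _ [n _ <-].
  exact/ltW/orbit_gt.
apply: orbit_cvg_fixed => //.
apply: (qm_interval qm (qm_fixed_mem qm) Ix); apply/andP; split.
  by apply: limr_ge => //; apply: nearW => n; exact/ltW/orbit_gt.
exact: (nonincreasing_cvgn_ge dec cx 0).
Qed.

Lemma orbit_cvg_lt x : I x -> x < s0 -> iter n beta x @[n --> \oo] --> s0.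
Proof.
move=> Ix sx.
have inc : {homo (fun n => iter n beta x) : n m / (n <= m)%N >-> n <= m}.
  apply/nondecreasing_seqP => n /=; apply/ltW/quantum_map_gt.
    exact: orbit_mem.
  exact: orbit_lt.
have cx : cvgn (fun n => iter n beta x).
  apply: nondecreasing_is_cvgn => //; exists s0 => _ [n _ <-].
  exact/ltW/orbit_lt.
apply: orbit_cvg_fixed => //.
apply: (qm_interval qm Ix (qm_fixed_mem qm)); apply/andP; split.
  exact: (nondecreasing_cvgn_le inc cx 0).
by apply: limr_le => //; apply: nearW => n; exact/ltW/orbit_lt.
Qed.

Lemma beta_deriveK (u : R -> R) t : I t -> t != s0 ->
  u t - u (beta t) = (t - beta t) * beta_derive beta s0 u t.
Proof.
move=> It ts; rewrite /beta_derive (negbTE ts).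
have : beta t - t != 0 by rewrite subr_eq0 quantum_map_neq.
by move=> ?; field.
Qed.

End orbits.

Lemma beta_derive_le_norm (R : realType) (beta : R -> R) (s0 a b : R)
    (u : R -> R) (t : R) :
  beta_derive_bounded beta s0 a b u ->
  beta_interval beta s0 a b t -> t != s0 ->
  `|beta_derive beta s0 u t| <= beta_derive_norm beta s0 a b u.
Proof.
move=> bd bt ts; apply: ub_le_sup; last first.
  by exists t => //; split => // /eqP; rewrite (negbTE ts).
have [B [_ hB]] := bd; exists (B + 1) => _ [x xA <-].
by apply: (hB (B + 1)) => //; rewrite ltrDl.
Qed.

(** * The estimate with constant 1/2 *)

Section estimate.
Context {R : realType} {I : set R} {beta : R -> R} {s0 a b : R}.
Context {f u : R -> R} {m M : R}.
Hypothesis adm : admissible I beta s0 a b f u m M.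

Let qm := adm_map adm.
Let Ia := adm_a adm.
Let Ib := adm_b adm.
Let a_lt := adm_lt_a adm.
Let b_gt := adm_lt_b adm.
Let D := beta_derive beta s0 u.
Let L := beta_derive_norm beta s0 a b u.

Let orbit_a_neq k : iter k beta a != s0.
Proof. by rewrite lt_eqF// (orbit_lt qm). Qed.

Let orbit_b_neq k : iter k beta b != s0.
Proof. by rewrite gt_eqF// (orbit_gt qm). Qed.

Let gap_a k : iter k beta a - iter k.+1 beta a <= 0.
Proof.
rewrite subr_le0; apply/ltW/(quantum_map_gt qm); first exact: (orbit_mem qm).
exact: (orbit_lt qm).
Qed.

Let gap_b k : 0 <= iter k beta b - iter k.+1 beta b.
Proof.
rewrite subr_ge0; apply/ltW/(quantum_map_lt qm); first exact: (orbit_mem qm).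
exact: (orbit_gt qm).
Qed.

Let D_a k : `|D (iter k beta a)| <= L.
Proof.
by apply: beta_derive_le_norm; [exact: adm_derive adm|left; left; exists k|].
Qed.

Let D_b k : `|D (iter k beta b)| <= L.
Proof.
by apply: beta_derive_le_norm; [exact: adm_derive adm|left; right; exists k|].
Qed.

Let stieltjes_termE x k : I x -> iter k beta x != s0 ->
  stieltjes_term beta f u x k =
  (iter k beta x - iter k.+1 beta x) * (f (iter k beta x) * D (iter k beta x)).
Proof.
move=> Ix xs; rewrite /stieltjes_term !iterS.
by rewrite (beta_deriveK qm u _ (orbit_mem qm x k Ix) xs) mulrCA.
Qed.

Lemma beta_integrable_admissible : beta_integrable beta a b f.
Proof.
have [ia ib] := adm_integrable adm; split.
  apply: (is_cvg_series_dominated R (-1)) ia => k.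
  by rewrite /beta_term normrM ler0_norm// mulN1r mulNr.
apply: (is_cvg_series_dominated R 1) ib => k.
by rewrite /beta_term normrM ger0_norm// mul1r.
Qed.

(** Since [D] is bounded by [L] on both orbits, each term is at most [L] times the size of the gap
    times [|f|], which is summable. *)
Lemma stieltjes_integrable_admissible : stieltjes_integrable beta a b f u.
Proof.
have [ia ib] := adm_integrable adm; split.
  apply: (is_cvg_series_dominated R (- L)) ia => k.
  rewrite stieltjes_termE// /beta_term !normrM ler0_norm//.
  have := ler_wpM2l (normr_ge0 (f (iter k beta a))) (D_a k).
  have := gap_a k; set p := _ - _; nra.
apply: (is_cvg_series_dominated R L) ib => k.
rewrite stieltjes_termE// /beta_term !normrM ger0_norm//.
have := ler_wpM2l (normr_ge0 (f (iter k beta b))) (D_b k).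
have := gap_b k; set p := _ - _; nra.
Qed.

(** Telescoped forms of the total mass of the first [n] gaps on both orbits and, for [increment], of
    the sum of [D] against these gaps. *)
Let width n := (b - iter n beta b) - (a - iter n beta a).
Let increment n := (u b - u (iter n beta b)) - (u a - u (iter n beta a)).

(** The finite Gruss inequality on the first [n] points of each orbit; [0 < n] makes the total mass
    positive. *)
Let gruss_truncated n : (0 < n)%N ->
  `|series (stieltjes_term beta f u b) n - series (stieltjes_term beta f u a) n
    - increment n / width n
      * (series (beta_term beta f b) n - series (beta_term beta f a) n)|
  <= 1 / 2 * L * (M - m) * width n.
Proof.
move=> n0.
pose x (i : 'I_n + 'I_n) :=
  match i with inl k => iter k beta b | inr k => iter k beta a end.
(* Gaps on the side of [a] are reversed to make every weight nonnegative; this matches the minus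
   sign before the integrals from [s0] to [a]. *)
pose w i := match i with inl _ => x i - beta (x i) | inr _ => beta (x i) - x i end.
have sumE (g : R -> R) : \sum_i w i * g (x i) =
    series (fun k => (iter k beta b - iter k.+1 beta b) * g (iter k beta b)) n -
    series (fun k => (iter k beta a - iter k.+1 beta a) * g (iter k beta a)) n.
  rewrite big_sumType/= !seriesEord/= -sumrN; congr (_ + _).
  by apply: eq_bigr => i _; rewrite -mulNr opprB.
have widthE : \sum_i w i = width n.
  rewrite /width -(series_telescope R (fun k => iter k beta b)).
  rewrite -(series_telescope R (fun k => iter k beta a)).
  have := sumE (fun=> 1); under eq_bigr do rewrite mulr1; move=> ->.
  by congr (series _ n - series _ n); apply/funext => k; rewrite mulr1.
have incE : \sum_i w i * D (x i) = increment n.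
  rewrite sumE /increment -(series_telescope R (fun k => u (iter k beta b))).
  rewrite -(series_telescope R (fun k => u (iter k beta a))).
  congr (series _ n - series _ n); apply/funext => k;
    by rewrite -(beta_deriveK qm)//; exact: (orbit_mem qm).
have stE : \sum_i w i * (f (x i) * D (x i)) =
    series (stieltjes_term beta f u b) n - series (stieltjes_term beta f u a) n.
  rewrite (sumE (fun y => f y * D y)).
  by congr (series _ n - series _ n); apply/funext => k; rewrite stieltjes_termE.
rewrite -stE -incE -widthE -[series _ n - series _ n]sumE.
apply: gruss_finite => [[k|k]|[k|k]|[k|k]|] /=.
- exact: gap_b.
- by rewrite -oppr_le0 opprB; exact: gap_a.
- exact: D_b.
- exact: D_a.
- by apply: (adm_range adm); left; right; exists k.
- by apply: (adm_range adm); left; left; exists k.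
- rewrite widthE /width.
  (* Both summands are positive: the first step of each orbit is strict, and later ones move further
     towards [s0]. *)
  have -> : forall p q r s : R, p - q - (r - s) = (p - q) + (s - r).
    by move=> p q r s; ring.
  case: n n0 {x w sumE widthE incE stE} => // n _; rewrite addr_gt0// subr_gt0.
    elim: n => /= [|n]; first exact: (quantum_map_lt qm).
    apply: le_lt_trans; apply/ltW/(quantum_map_lt qm).
      exact: (orbit_mem qm b n.+1).
    exact: (orbit_gt qm b n.+1).
  elim: n => /= [|n]; first exact: (quantum_map_gt qm).
  move=> /lt_le_trans; apply; apply/ltW/(quantum_map_gt qm).
    exact: (orbit_mem qm a n.+1).
  exact: (orbit_lt qm a n.+1).
Qed.

(** Both sides of the truncated inequality converge; the quotient does because [width] tends to
    [b - a], which is nonzero. *)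
Lemma gruss_estimate_half : gruss_estimate (1 / 2) beta s0 a b f u m M.
Proof.
have [sa sb] := stieltjes_integrable_admissible.
have [fa fb] := beta_integrable_admissible.
have width_cvg : width n @[n --> \oo] --> b - a.
  have -> : b - a = (b - s0) - (a - s0) by ring.
  apply: cvgB; apply: cvgB; try exact: cvg_cst.
    exact: (orbit_cvg_gt qm).
  exact: (orbit_cvg_lt qm).
have inc_cvg : increment n @[n --> \oo] -->
    u b - u a - (orbit_lim beta u b - orbit_lim beta u a).
  have -> : u b - u a - (orbit_lim beta u b - orbit_lim beta u a) =
    (u b - orbit_lim beta u b) - (u a - orbit_lim beta u a) by ring.
  apply: cvgB; apply: cvgB; try exact: cvg_cst.
    exact: (adm_lim_b adm).
  exact: (adm_lim_a adm).
have ba0 : b - a != 0 by rewrite subr_eq0 gt_eqF// (lt_trans a_lt).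
rewrite /gruss_estimate /stieltjes_integral /beta_integral /beta_integral0 -/L.
set J := (X in `|X|).
have lhs_cvg : `|series (stieltjes_term beta f u b) n
    - series (stieltjes_term beta f u a) n
    - increment n / width n
      * (series (beta_term beta f b) n - series (beta_term beta f a) n)|
    @[n --> \oo] --> `|J|.
  apply: cvg_norm; apply: cvgB; first exact: cvgB.
  by apply: cvgM; [apply: cvgM => //; exact: cvgV|exact: cvgB].
have rhs_cvg : 1 / 2 * L * (M - m) * width n @[n --> \oo] -->
    1 / 2 * L * (M - m) * (b - a).
  by apply: cvgM => //; exact: cvg_cst.
by apply: ler_cvg_to lhs_cvg rhs_cvg _; exists 1%N => // n; exact: gruss_truncated.
Qed.

End estimate.

(** * Sharpness of the constant *)

Section sharpness.
Context {R : realType}.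

Definition halving (t : R) : R := t / 2.

Lemma iter_halving k (t : R) : iter k halving t = t * 2^-1 ^+ k.
Proof.
by elim: k => [|k IH]; rewrite ?mulr1// iterS IH /halving exprSr mulrA.
Qed.

Let pow_cvg : (2^-1 : R) ^+ n @[n --> \oo] --> (0 : R).
Proof. by apply: cvg_expr; rewrite ger0_norm ?invr_ge0// invf_lt1// ltr1n. Qed.

Let pow_gt0 k : 0 < (2^-1 : R) ^+ k.
Proof. by rewrite exprn_gt0// invr_gt0. Qed.

(** The partial sums telescope to [c - c * 2^-1 ^+ n]. The series of the example reduce to this
    form, with [c] equal to [x] or [Num.sg x]. *)
Let geometric_cvg (c : R) :
  series (fun k => c * (2^-1 ^+ k - 2^-1 ^+ k.+1)) n @[n --> \oo] --> c.
Proof.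
have -> : series (fun k => c * (2^-1 ^+ k - 2^-1 ^+ k.+1)) =
    (fun n => c - c * 2^-1 ^+ n).
  apply/funext => n.
  have := series_telescope R (fun k => c * 2^-1 ^+ k) n.
  rewrite expr0 mulr1 => <-; congr (series _ n).
  by apply/funext => k; rewrite mulrBr.
rewrite -[X in _ --> X]subr0; apply: cvgB; first exact: cvg_cst.
by rewrite -(mulr0 c); apply: cvgM; [exact: cvg_cst|].
Qed.

Lemma halving_quantum_map : quantum_map [set: R] halving 0.
Proof.
rewrite /halving; split => //.
- by move=> s t _ _; rewrite ltr_pM2r// invr_gt0.
- by apply: continuous_subspaceT => x; exact: mulrr_continuous.
- by rewrite mul0r.
- by move=> t _ ?; lra.
- by move=> t _; rewrite subr0; have := sqr_ge0 t; nra.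
- move=> t _ /eqP; rewrite subr0 mulf_eq0 => /orP[/eqP//|/eqP ?]; lra.
Qed.

Lemma halving_derive_norm (t : R) : t != 0 -> `|beta_derive halving 0 Num.norm t| = 1.
Proof.
move=> t0; rewrite /beta_derive (negbTE t0) /halving.
have -> : `|t / 2| = `|t| / 2 by rewrite normrM [X in _ * X]ger0_norm// invr_ge0.
(* The difference quotient of the absolute value is thus the sign of [t]. *)
have -> : `|t| / 2 - `|t| = (t / 2 - t) * (`|t| / t) by field.
have h : t / 2 - t != 0.
  by apply: contra t0 => /eqP ?; apply/eqP; lra.
by rewrite mulrAC divff// mul1r normrM normfV normr_id divff// normr_eq0.
Qed.

Lemma halving_derive_sup : beta_derive_norm halving 0 (-1) 1 Num.norm = 1 :> R.
Proof.
rewrite /beta_derive_norm [X in sup X](_ : _ = [set 1]) ?sup1//.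
apply/seteqP; split => [_ [t [_ /eqP t0] <-]|_ ->] /=.
  exact: halving_derive_norm.
exists 1; last by rewrite halving_derive_norm// oner_eq0.
by split; [left; right; exists 0%N|exact/eqP/oner_neq0].
Qed.

Let abs_orbit (x : R) k : `|x| = 1 -> `|iter k halving x| = 2^-1 ^+ k.
Proof. by move=> x1; rewrite iter_halving normrM x1 mul1r ger0_norm// ltW. Qed.

Let sg_orbit (x : R) k : Num.sg (iter k halving x) = Num.sg x.
Proof. by rewrite iter_halving sgrM (gtr0_sg (pow_gt0 k)) mulr1. Qed.

Let abs_sg_integrable (x : R) : `|x| = 1 ->
  cvgn (series (beta_term halving (fun t => `|Num.sg t|) x)).
Proof.
move=> x1; apply/cvg_ex; exists x.
rewrite [beta_term _ _ _](_ : _ = fun k => x * (2^-1 ^+ k - 2^-1 ^+ k.+1)) //.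
apply/funext => k; rewrite /beta_term sg_orbit normr_sg -normr_eq0 x1.
by rewrite oner_eq0 mulr1 !iter_halving mulrBr.
Qed.

Let orbit_abs_cvg (x : R) : `|x| = 1 ->
  `|iter n halving x| @[n --> \oo] --> (0 : R).
Proof.
move=> x1; rewrite (_ : (fun n => _) = fun n => 2^-1 ^+ n)//.
by apply/funext => n; rewrite abs_orbit.
Qed.

Lemma halving_admissible :
  admissible [set: R] halving 0 (-1) 1 Num.sg Num.norm (-1) 1.
Proof.
have n1 : `|-1 : R| = 1 by rewrite normrN1.
split => //.
- exact: halving_quantum_map.
- by split; apply: abs_sg_integrable; rewrite ?normr1.
- by move=> x _; rewrite -ler_norml normr_sg; case: eqP.
- exists 1; split => // B B1 t [_ /eqP t0] /=.
  by rewrite halving_derive_norm// ltW.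
- by apply/cvg_ex; exists 0; exact: orbit_abs_cvg.
- by apply/cvg_ex; exists 0; apply: orbit_abs_cvg; rewrite normr1.
Qed.

Let stieltjes_sg (x : R) : `|x| = 1 ->
  limn (series (stieltjes_term halving Num.sg Num.norm x)) = Num.sg x.
Proof.
move=> x1; apply/cvg_lim => //.
rewrite [stieltjes_term _ _ _ _](_ : _ =
  fun k => Num.sg x * (2^-1 ^+ k - 2^-1 ^+ k.+1)) //.
by apply/funext => k; rewrite /stieltjes_term sg_orbit !abs_orbit.
Qed.

(** The mean term vanishes, as [u] agrees at the endpoints and both orbit limits are 0. The
    Stieltjes integral is [1 - (-1) = 2] and the right side is [4 * c]. *)
Lemma halving_gruss_estimate (c : R) :
  gruss_estimate c halving 0 (-1) 1 Num.sg Num.norm (-1) 1 -> 1 / 2 <= c.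
Proof.
rewrite /gruss_estimate halving_derive_sup /stieltjes_integral.
rewrite !stieltjes_sg ?normrN1 ?normr1// sgrN sgr1.
have -> : orbit_lim halving Num.norm 1 = 0 :> R.
  by apply/cvg_lim => //; apply: orbit_abs_cvg; rewrite normr1.
have -> : orbit_lim halving Num.norm (-1) = 0 :> R.
  by apply/cvg_lim => //; apply: orbit_abs_cvg; rewrite normrN1.
rewrite !subrr mul0r mul0r subr0 opprK ger0_norm ?addr_ge0//; lra.
Qed.

End sharpness.

Theorem corollary4p12 (R : realType) :
  (forall (I : set R) (beta : R -> R) (s0 a b : R) (f u : R -> R) (m M : R),
     admissible I beta s0 a b f u m M ->
     stieltjes_integrable beta a b f u /\
     gruss_estimate (1 / 2) beta s0 a b f u m M) /\
  ~ (exists c : R, c < 1 / 2 /\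
       forall (I : set R) (beta : R -> R) (s0 a b : R) (f u : R -> R) (m M : R),
         admissible I beta s0 a b f u m M ->
         gruss_estimate c beta s0 a b f u m M).
Proof.
split=> [I beta s0 a b f u m M adm|[c [c_lt /(_ _ _ _ _ _ _ _ _ _ halving_admissible)]]].
  by split; [exact: stieltjes_integrable_admissible adm|
             exact: gruss_estimate_half adm].
by move=> /halving_gruss_estimate; rewrite leNgt c_lt.
Qed.
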